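(* Let $S=(X,P)$ be a stochastic approximation space, let $T:X\to P^*(X)$ be a set-valued mapping, and let $U$ be a random variable on $X$ with finitely many values $u_1,\dots,u_n$. Then $$\overline{V}(U)=\overline{E}(U^2)-(2-d)\,(\overline{E}(U))^2,\qquad\text{where } d=\sum_{k=1}^n \overline{P}(U=u_k).$$
   Context: $P^*(X)$ denotes the set of all non-empty subsets of a non-empty set $X$. A stochastic approximation space is a pair $S=(X,P)$ where $X$ is a non-empty set and $P$ is a probability measure on $X$. For a set-valued mapping $T:X\to P^*(X)$ and $A\subseteq X$, the upper inverse of $A$ is $T^{-1}(A)=\{x\in X : T(x)\cap A\neq\emptyset\}$. It is understood that $T^{-1}(A)$ is an event whenever $A$ is. The upper probability of an event $A$ is $\overline{P}(A)=P(T^{-1}(A))$. A random variable $U$ is a real-valued random variable on $X$ taking finitely many distinct values $u_1,\dots,u_n$, and $\overline{P}(U=u_k)=\overline{P}(\{x\in X: U(x)=u_k\})$. The upper expectation of $U$ is $\overline{E}(U)=\sum_{k=1}^n u_k\,\overline{P}(U=u_k)$, and for a function $g:\mathbb{R}\to\mathbb{R}$ the upper expectation of $g(U)$ is understood as $\overline{E}(g(U))=\sum_{k=1}^n g(u_k)\,\overline{P}(U=u_k)$. The upper variance of $U$ is $\overline{V}(U)=\overline{E}\big((U-\overline{E}(U))^2\big)$. *)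

(* Defs.v *)
From mathcomp Require Import all_boot all_order all_algebra.
From mathcomp Require Import all_classical all_reals all_analysis.
Import Order.TTheory GRing.Theory Num.Theory.
Import numFieldNormedType.Exports.

Set Implicit Arguments.
Unset Strict Implicit.
Unset Printing Implicit Defensive.

Local Open Scope classical_set_scope.
Local Open Scope ring_scope.

Definition upper_inverse (X : Type) (T : X -> set X) (A : set X) : set X :=
  [set x | T x `&` A !=set0].

(* [fine] loses nothing: a probability measure only takes finite values. *)
Definition upper_prob (R : realType) (disp : measure_display)
    (X : measurableType disp) (P : probability X R) (T : X -> set X)
    (A : set X) : R :=
  fine (P (upper_inverse T A)).

(* The upper expectation of g(U). The sum runs over the distinct values of U,
   not over those of g \o U: since [upper_prob] is not additive, grouping the
   values of U identified by g would change the result.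
   Meaningful only when [range U] is finite. *)
Definition upper_expectation_comp (R : realType) (disp : measure_display)
    (X : measurableType disp) (P : probability X R) (T : X -> set X)
    (g : R -> R) (U : {RV P >-> R}) : R :=
  \sum_(u \in range U) g u * upper_prob P T [set x | U x = u].

Definition upper_expectation (R : realType) (disp : measure_display)
    (X : measurableType disp) (P : probability X R) (T : X -> set X)
    (U : {RV P >-> R}) : R :=
  \sum_(u \in range U) u * upper_prob P T [set x | U x = u].

Definition upper_variance (R : realType) (disp : measure_display)
    (X : measurableType disp) (P : probability X R) (T : X -> set X)
    (U : {RV P >-> R}) : R :=
  upper_expectation_comp T (fun t => (t - upper_expectation T U) ^+ 2) U.

(* Main.v *)
Require Import Defs.
From mathcomp Require Import all_boot all_order all_algebra.
From mathcomp Require Import all_classical all_reals all_analysis.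
From mathcomp Require Import ring.
Import Order.TTheory GRing.Theory Num.Theory.
Import numFieldNormedType.Exports.

Local Open Scope classical_set_scope.
Local Open Scope ring_scope.

(** Expand the square $(u-E)^2$ under the weights $\overline{P}(U=u)$, where $E=\overline{E}(U)$.
    The cross terms sum to $-2E^2$, as for an ordinary variance, but the constant term gives $dE^2$,
    since the total weight $d$ may differ from 1. *)

Theorem theorem2p20 (R : realType) (disp : measure_display)
    (X : measurableType disp) (P : probability X R)
    (T : X -> set X) (T_nonempty : forall x : X, T x !=set0)
    (T_event : forall A : set X, measurable A -> measurable (upper_inverse T A))
    (U : {RV P >-> R}) (U_finite : finite_set (range U)) :
  let d := \sum_(u \in range U) upper_prob P T [set x | U x = u] in
  upper_variance T U =
    upper_expectation_comp T (fun t => t ^+ 2) U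
    - (2 - d) * (upper_expectation T U) ^+ 2.
Proof.
move=> d; rewrite /upper_variance /upper_expectation_comp.
have : upper_expectation T U =
  \sum_(u \in range U) u * upper_prob P T [set x | U x = u] by [].
(* [E] becomes an opaque constant; [EE] keeps its value as a sum. *)
move: (upper_expectation T U) => E EE.
(* One factor [E] is isolated to be expanded as a sum by [EE]; the others stay as coefficients, so
   the identity can be checked for each [u]. *)
have -> : (2 - d) * E ^+ 2 = 2 * E * E - E ^+ 2 * d by ring.
rewrite [X in 2 * E * X]EE /d !fsbig_finite//= !mulr_sumr -!sumrB.
by apply: eq_bigr => u _; ring.
Qed.
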